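(* Let $\lambda<1$, $\lambda\neq0$, and $q=1-\lambda>0$. Consider the $\lambda$-mixture family $\{p_\eta\}$ with respect to probability densities $p_0,\dots,p_d$, where all integrals involved in its definition converge for all $\eta$, and suppose that the integral $\int\left(\sum_{i=0}^d\eta_i\widetilde p_i\right)^{1/q}d\nu$ can be differentiated with respect to $\eta$ under the integral sign when $\eta\in\Delta^d$. Consider the negative Rényi entropy $$\psi(\eta)=-\mathbf{H}_q^{\mathrm{R\acute{e}nyi}}(p_\eta).$$ Then $\frac1\lambda\left(e^{\lambda\psi}-1\right)$ is convex (as a function of $\eta$). Moreover, the $\lambda$-logarithmic divergence of $\psi$ is the Rényi divergence of order $q$: for all mixture parameters $\eta$ and all $\eta'\in\Delta^d$, $$\mathbf{L}_{\lambda,\psi}[\eta:\eta']=\mathbf{H}_q^{\mathrm{R\acute{e}nyi}}(p_\eta\,\|\,p_{\eta'}).$$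
   Context: Let $p_0,\dots,p_d$ be probability densities with respect to a measure $\nu$. The escort transformation with exponent $\alpha\neq0$ is $\mathcal{E}_\alpha[p]=p^\alpha/\int p^\alpha\,d\nu$. With $q=1-\lambda$ and $\widetilde p_i=\mathcal{E}_q[p_i]$, the $\lambda$-mixture family is $$p_\eta=\mathcal{E}_{1/q}\Big[\sum_{i=0}^d\eta_i\widetilde p_i\Big]=\frac{\left(\sum_{i=0}^d\eta_i\widetilde p_i\right)^{1/q}}{\int\left(\sum_{j=0}^d\eta_j\widetilde p_j\right)^{1/q}d\nu},$$ where $\eta=(\eta_0,\dots,\eta_d)$, $\eta_i\ge0$, $\sum_{i=0}^d\eta_i=1$. $\Delta^d=\{\eta:\eta_i>0,\ \sum_{i=0}^d\eta_i=1\}$ is the open unit simplex. Rényi entropy: $\mathbf{H}_q^{\mathrm{R\acute{e}nyi}}(p)=\frac1{1-q}\log\int p^q\,d\nu$. Rényi divergence: $\mathbf{H}_q^{\mathrm{R\acute{e}nyi}}(p_1\|p_2)=\frac1{q-1}\log\int p_1^q\,p_2^{1-q}\,d\nu$ (the integrand being $0$ where $p_1=0$). $\lambda$-logarithmic divergence of a function $f$ with $\frac1\lambda(e^{\lambda f}-1)$ convex, differentiable at $u'$: $\mathbf{L}_{\lambda,f}[u:u']=f(u)-f(u')-\frac1\lambda\log\left(1+\lambda\nabla f(u')\cdot(u-u')\right)$. For $f=\psi$ on the simplex, $\nabla\psi(\eta')\cdot(\eta-\eta')$ is the derivative of $\psi$ at $\eta'$ in the tangent direction $\eta-\eta'$.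 *)

(* Defs.v *)
From mathcomp Require Import all_boot all_order all_algebra.
From mathcomp Require Import all_classical all_reals all_analysis.
Import Order.TTheory GRing.Theory Num.Theory.
Import numFieldNormedType.Exports.
Set Implicit Arguments.
Unset Strict Implicit.
Unset Printing Implicit Defensive.
Local Open Scope classical_set_scope.
Local Open Scope ring_scope.

Section Simplex.
Context {R : realType} {d : nat}.
Implicit Types (u v eta : 'rV[R]_d.+1) (f : 'rV[R]_d.+1 -> R).

Definition closed_simplex : set 'rV[R]_d.+1 :=
  [set eta | (forall i, 0 <= eta 0 i) /\ \sum_i eta 0 i = 1].

Definition open_simplex : set 'rV[R]_d.+1 :=
  [set eta | (forall i, 0 < eta 0 i) /\ \sum_i eta 0 i = 1].

Definition tangent : set 'rV[R]_d.+1 := [set v | \sum_i v 0 i = 0].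

(* Frechet differentiability at [u] of the restriction of [f] to the affine
   hyperplane [u + tangent]; the values of [f] off this hyperplane are not
   used. *)
Definition simplex_differentiable f u : Prop :=
  exists L : {linear 'rV[R]_d.+1 -> R},
    forall e : R, 0 < e ->
      \forall v \near (0 : 'rV[R]_d.+1),
        tangent v -> `|f (u + v) - f u - L v| <= e * `|v|.

(* For [u, u'] in the simplex the direction [u - u'] is tangent to it. *)
Definition log_div_arg (lam : R) f u u' : R := 1 + lam * 'D_(u - u') f u'.

Definition log_div (lam : R) f u u' : R :=
  f u - f u' - lam^-1 * ln (log_div_arg lam f u u').

End Simplex.

Section Densities.
Context {dT : measure_display} {T : measurableType dT} {R : realType}.
Variable nu : {measure set T -> \bar R}.

Definition density (p : T -> R) : Prop :=
  [/\ measurable_fun setT p,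
      forall x, 0 <= p x &
      (\int[nu]_x (p x)%:E = 1)%E].

Definition integrableR (f : T -> R) : Prop :=
  nu.-integrable setT (EFin \o f).

Definition escort (alpha : R) (p : T -> R) : T -> R :=
  fun x => p x `^ alpha / \int[nu]_(y in setT) (p y `^ alpha).

(* Entropy and divergence are extended real valued: [lne] is the logarithm
   with [lne 0 = -oo] and [lne +oo = +oo]. *)
Definition renyi_entropy (q : R) (p : T -> R) : \bar R :=
  ((1 - q)^-1%:E * lne (\int[nu]_x (p x `^ q)%:E))%E.

(* [a ^ q * b ^ (1 - q)]; since [powR 0 r = 0] for every [r != 0], the value
   [+oo] of [0 ^ (1 - q)] for [1 < q] has to be given explicitly. *)
Definition renyi_integrand (q a b : R) : \bar R :=
  if a == 0 then 0%E
  else if (b == 0) && (1 < q) then +oo%E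
  else (a `^ q * b `^ (1 - q))%:E.

Definition renyi_div (q : R) (p1 p2 : T -> R) : \bar R :=
  ((q - 1)^-1%:E * lne (\int[nu]_x renyi_integrand q (p1 x) (p2 x)))%E.

Definition derive_under_integral (V : normedModType R) (F : V -> T -> R)
    (a v : V) : Prop :=
  let I := fun u : V => \int[nu]_(x in setT) F u x in
  [/\ {ae nu, forall x, derivable (F^~ x : V -> R) a v},
      integrableR (fun x => 'D_v (F^~ x : V -> R) a),
      derivable (I : V -> R) a v &
      'D_v (I : V -> R) a = \int[nu]_(x in setT) 'D_v (F^~ x : V -> R) a].

Section Mixture.
Context {d : nat}.
Variables (lam : R) (p : 'I_d.+1 -> T -> R).

Definition escort_sum (eta : 'rV[R]_d.+1) : T -> R :=
  fun x => \sum_i eta 0 i * escort (1 - lam) (p i) x.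

Definition escort_sum_pow (eta : 'rV[R]_d.+1) : T -> R :=
  fun x => escort_sum eta x `^ (1 - lam)^-1.

Definition lambda_mixture (eta : 'rV[R]_d.+1) : T -> R :=
  escort (1 - lam)^-1 (escort_sum eta).

Definition neg_renyi_entropy (eta : 'rV[R]_d.+1) : R :=
  fine (- renyi_entropy (1 - lam) (lambda_mixture eta))%E.

End Mixture.
End Densities.

(* Main.v *)
(* Write q = 1 - lam, r = 1 / q, S_eta for the mixture of the escort densities
   and W(eta) for the integral of S_eta ^ r.  Since S_eta integrates to 1, the
   integral of p_eta ^ q is W(eta) ^ (-q), hence psi = (q / lam) ln W and
   exp (lam psi) = W ^ q is the L^r norm of S_eta: convexity of
   (W ^ q - 1) / lam is Minkowski's inequality for 0 < lam and the reverse
   Minkowski inequality for lam < 0.  At an interior eta' one has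
   |S_v| <= C |v| S_eta' pointwise, so the expansion of (1 + h) ^ r at h = 0
   gives the Frechet differential v |-> r \int S_eta' ^ (r - 1) S_v of W.
   Taking v = eta - eta', the argument of the logarithm in the
   lam-logarithmic divergence is \int S_eta' ^ (r - 1) S_eta / W(eta'), which
   up to powers of W(eta) and W(eta') is the integral in the Renyi
   divergence. *)
Require Import Defs.
From HB Require Import structures.
From mathcomp Require Import all_boot all_order all_algebra.
From mathcomp Require Import all_classical all_reals all_analysis.
From mathcomp Require Import measurable_realfun ring.
Import Order.TTheory GRing.Theory Num.Theory.
Import numFieldNormedType.Exports.
Local Open Scope classical_set_scope.
Local Open Scope ring_scope.

Set Implicit Arguments.
Unset Strict Implicit.
Unset Printing Implicit Defensive.

(** * Integrals of real-valued functions, with a criterion for positivity *)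

Section RealIntegral.
Context {dT : measure_display} {T : measurableType dT} {R : realType}.
Variable nu : {measure set T -> \bar R}.
Implicit Types f g : T -> R.

Lemma EFin_Rintegral f : integrableR nu f ->
  (\int[nu]_x (f x)%:E)%E = (\int[nu]_x f x)%:E.
Proof. by move=> fi; rewrite /Rintegral fineK//; exact: integrable_fin_num. Qed.

Lemma integrableR_measurable f : integrableR nu f -> measurable_fun setT f.
Proof. by move=> /measurable_int /measurable_EFinP. Qed.

Lemma integrableRZl k f : integrableR nu f ->
  integrableR nu (fun x => k * f x).
Proof. by move=> fi; exact: (integrableZl measurableT k fi). Qed.

Lemma integrableRD f g : integrableR nu f -> integrableR nu g ->
  integrableR nu (fun x => f x + g x).
Proof. by move=> fi gi; exact: (integrableD measurableT fi gi). Qed.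

Lemma integrableRB f g : integrableR nu f -> integrableR nu g ->
  integrableR nu (fun x => f x - g x).
Proof. by move=> fi gi; exact: (integrableB measurableT fi gi). Qed.

Lemma integrableR_le f g : measurable_fun setT f -> integrableR nu g ->
  (forall x, `|f x| <= g x) -> integrableR nu f.
Proof.
move=> mf gi fg; apply: (le_integrable measurableT _ _ gi).
  exact/measurable_EFinP.
by move=> x _ /=; rewrite lee_fin (le_trans (fg x))// ler_norm.
Qed.

(** If the integral of [f] were zero, [f] would vanish almost everywhere, hence so would [g],
    against its positive integral. *)
Lemma Rintegral_gt0 f g : integrableR nu f -> measurable_fun setT g ->
  (forall x, 0 <= f x) -> (forall x, 0 <= g x) ->
  (forall x, f x = 0 -> g x = 0) ->
  (0 < \int[nu]_x (g x)%:E)%E -> 0 < \int[nu]_x f x.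
Proof.
move=> fi mg f0 g0 fg gt0.
rewrite lt_neqAle Rintegral_ge0// andbT eq_sym; apply/eqP => If0.
suff : (\int[nu]_x (g x)%:E = 0)%E by move=> I0; rewrite I0 ltxx in gt0.
have : ae_eq nu setT (EFin \o f) (cst 0%E).
  apply/ae_eq_integral_abs => //; first exact: measurable_int fi.
  under eq_integral do rewrite /= ger0_norm//.
  by rewrite EFin_Rintegral// If0.
move=> f_ae0; rewrite (ge0_ae_eq_integral (g := cst 0%E))//.
- by rewrite integral0.
- exact/measurable_EFinP.
- by move=> x _; rewrite lee_fin.
by apply: filterS f_ae0 => x /= /(_ I) [] /fg ->.
Qed.

End RealIntegral.

(** * Powers of nonnegative reals: inverses, convexity and concavity *)

Section Concavity.
Context {R : realType}.
Implicit Types (a b r t : R).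

Lemma powRVK r a : r != 0 -> 0 <= a -> (a `^ r^-1) `^ r = a.
Proof. by move=> r0 a0; rewrite -powRrM mulVf// powRr1. Qed.

Lemma powRK r a : r != 0 -> 0 <= a -> (a `^ r) `^ r^-1 = a.
Proof. by move=> r0 a0; rewrite -powRrM mulfV// powRr1. Qed.

Lemma powR_div r a b : 0 <= a -> 0 <= b -> (a / b) `^ r = a `^ r / b `^ r.
Proof.
move=> a0 b0; rewrite powRM ?invr_ge0//; congr (_ * _).
by rewrite -powR_inv1// powRAC powR_inv1// powR_ge0.
Qed.

Lemma convex_powR_le r t a b : 1 <= r -> 0 <= t <= 1 -> 0 <= a -> 0 <= b ->
  (t * a + (1 - t) * b) `^ r <= t * a `^ r + (1 - t) * b `^ r.
Proof.
move=> r1 /andP[t0 t1] a0 b0.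
have := @convex_powR R r r1 (Itv01 t0 t1) a b.
rewrite !inE /= !in_itv /= !andbT => /(_ a0 b0).
by rewrite !convRE.
Qed.

(** This is convexity of the power [r^-1] at the points [a ^ r] and [b ^ r], followed by the
    monotone power [r]. *)
Lemma concave_powR_ge r t a b : 0 < r <= 1 -> 0 <= t <= 1 -> 0 <= a -> 0 <= b ->
  t * a `^ r + (1 - t) * b `^ r <= (t * a + (1 - t) * b) `^ r.
Proof.
move=> /andP[r0 r1] t01 a0 b0; have /andP[t0 t1] := t01.
have rn0 : r != 0 by rewrite gt_eqF.
have r'1 : 1 <= r^-1 by rewrite invf_ge1.
have := convex_powR_le r'1 t01 (powR_ge0 a r) (powR_ge0 b r).
rewrite -!powRrM mulfV// !powRr1// => H.
have s0 : 0 <= t * a `^ r + (1 - t) * b `^ r.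
  by rewrite addr_ge0// mulr_ge0 ?powR_ge0// subr_ge0.
rewrite -[leLHS](powRVK (r := r))//.
by apply: ge0_ler_powR => //; rewrite ?nnegrE ?powR_ge0 ?(ltW r0)//;
  rewrite addr_ge0 ?mulr_ge0// subr_ge0.
Qed.

(* [1 <= (1 - lam)^-1] iff [0 <= lam], so the factor [lam^-1] treats the convex
   and the concave powers at once. *)
Lemma signed_convex_powR (lam t a b : R) :
  lam < 1 -> lam != 0 -> 0 <= t <= 1 -> 0 <= a -> 0 <= b ->
  lam^-1 * (t * a + (1 - t) * b) `^ (1 - lam)^-1 <=
  lam^-1 * (t * a `^ (1 - lam)^-1 + (1 - t) * b `^ (1 - lam)^-1).
Proof.
move=> l1 l0 t01 a0 b0; have q0 : 0 < 1 - lam by rewrite subr_gt0.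
move: l0; rewrite neq_lt => /orP[l0|l0].
- rewrite ler_nM2l ?invr_lt0//; apply: concave_powR_ge => //.
  by rewrite invr_gt0 q0 invf_le1// lerBrDr gerDl ltW.
- rewrite ler_pM2l ?invr_gt0//; apply: convex_powR_le => //.
  by rewrite invf_ge1// gerBl ltW.
Qed.

(** A negative [lam^-1] reverses hypothesis and conclusion alike, and the power [1 - lam] is
    increasing in both cases. *)
Lemma signed_ler_powR (lam a b : R) : lam < 1 -> lam != 0 -> 0 <= a -> 0 <= b ->
  lam^-1 * a <= lam^-1 * b ->
  lam^-1 * a `^ (1 - lam) <= lam^-1 * b `^ (1 - lam).
Proof.
move=> l1 l0 a0 b0; have q0 : 0 <= 1 - lam by rewrite subr_ge0 ltW.
move: l0; rewrite neq_lt => /orP[l0|l0].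
- by rewrite !ler_nM2l ?invr_lt0// => ab; apply: ge0_ler_powR.
- by rewrite !ler_pM2l ?invr_gt0// => ab; apply: ge0_ler_powR.
Qed.

End Concavity.

(** * Minkowski's inequality and its reverse, in one signed form *)

Section Minkowski.
Context {dT : measure_display} {T : measurableType dT} {R : realType}.
Variables (nu : {measure set T -> \bar R}) (lam : R).
Hypotheses (lam_lt1 : lam < 1) (lam_neq0 : lam != 0).
Implicit Types f g : T -> R.

(** [Nf] and [Ng] are the L^r norms, specified through their powers. The scalar inequality is
    applied pointwise to the normalized functions, integrated, and raised to the power [1 - lam],
    the inverse of [r]. *)
Lemma signed_minkowski_aux f g (t Nf Ng : R) (r := (1 - lam)^-1) :
  0 <= t <= 1 ->
  (forall x, 0 <= f x) -> (forall x, 0 <= g x) ->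
  integrableR nu (fun x => f x `^ r) -> integrableR nu (fun x => g x `^ r) ->
  integrableR nu (fun x => (t * f x + (1 - t) * g x) `^ r) ->
  0 < Nf -> 0 < Ng ->
  Nf `^ r = \int[nu]_x (f x `^ r) -> Ng `^ r = \int[nu]_x (g x `^ r) ->
  lam^-1 * (\int[nu]_x ((t * f x + (1 - t) * g x) `^ r)) `^ (1 - lam) <=
  lam^-1 * (t * Nf + (1 - t) * Ng).
Proof.
move=> t01 f0 g0 fi gi hi Nf0 Ng0 NfK NgK; have /andP[t0 t1] := t01.
have q0 : 0 < 1 - lam by rewrite subr_gt0.
have qn0 : 1 - lam != 0 by rewrite gt_eqF.
have rn0 : r != 0 by rewrite invr_eq0.
pose M := t * Nf + (1 - t) * Ng.
have M0 : 0 < M.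
  rewrite /M; move: t0; rewrite le_eqVlt => /predU1P[<-|tgt0].
    by rewrite mul0r add0r subr0 mul1r.
  by rewrite ltr_wpDr ?mulr_gt0// mulr_ge0 ?subr_ge0// ltW.
have MrK : (M `^ r) `^ (1 - lam) = M by rewrite powRVK// ltW.
(* Weights for which [(t f + (1 - t) g) / M] is a convex combination of the
   normalized functions [f / Nf] and [g / Ng]. *)
pose m := t * Nf / M.
have m'E : 1 - m = (1 - t) * Ng / M.
  by rewrite /m -[X in X - _](mulfV (lt0r_neq0 M0)) -mulrBl /M addrAC subrr add0r.
have m01 : 0 <= m <= 1.
  by rewrite -[m <= 1]subr_ge0 m'E !divr_ge0 ?mulr_ge0 ?subr_ge0// ltW.
have pw x : lam^-1 * (t * f x + (1 - t) * g x) `^ r <=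
   lam^-1 * (M `^ r * (m / Nf `^ r) * f x `^ r +
     M `^ r * ((1 - m) / Ng `^ r) * g x `^ r).
  have -> : t * f x + (1 - t) * g x =
      M * (m * (f x / Nf) + (1 - m) * (g x / Ng)).
    rewrite m'E /m mulrDr; congr (_ + _).
      by field; rewrite !gt_eqF.
    by field; rewrite !gt_eqF.
  have fN : 0 <= f x / Nf by rewrite divr_ge0// ltW.
  have gN : 0 <= g x / Ng by rewrite divr_ge0// ltW.
  have c0 : 0 <= m * (f x / Nf) + (1 - m) * (g x / Ng).
    by case/andP: m01 => ? ?; rewrite addr_ge0// mulr_ge0// subr_ge0.
  rewrite powRM//; last exact: ltW.
  have := signed_convex_powR lam_lt1 lam_neq0 m01 fN gN.
  move=> /(ler_wpM2l (powR_ge0 M r)); rewrite [leLHS]mulrCA -/r => /le_trans; apply.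
  rewrite mulrCA le_eqVlt; apply/orP; left; apply/eqP; congr (_ * _).
  by rewrite !powR_div ?(ltW Nf0) ?(ltW Ng0)//; ring.
(* Integrating [pw]: the normalized powers have integral 1, so the bound becomes
   [M ^ r * (m + (1 - m))]. *)
have Wle : lam^-1 * \int[nu]_x ((t * f x + (1 - t) * g x) `^ r) <=
    lam^-1 * M `^ r.
  set a := M `^ r * (m / Nf `^ r) in pw.
  set b := M `^ r * ((1 - m) / Ng `^ r) in pw.
  have afi := integrableRZl a fi; have bgi := integrableRZl b gi.
  have -> : M `^ r = \int[nu]_x (a * f x `^ r + b * g x `^ r).
    rewrite RintegralD// !RintegralZl// -NfK -NgK /a /b.
    have Nfr : Nf `^ r != 0 by rewrite gt_eqF// powR_gt0.
    have Ngr : Ng `^ r != 0 by rewrite gt_eqF// powR_gt0.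
    by rewrite -!(mulrA (M `^ r)) !divfK// -mulrDr addrC subrK mulr1.
  rewrite -!RintegralZl//; last exact: integrableRD.
  by apply: le_Rintegral => //; apply: integrableRZl => //; exact: integrableRD.
have W0 : 0 <= \int[nu]_x ((t * f x + (1 - t) * g x) `^ r).
  by apply: Rintegral_ge0 => x _; exact: powR_ge0.
have := signed_ler_powR lam_lt1 lam_neq0 W0 (powR_ge0 M r) Wle.
by rewrite MrK.
Qed.

Lemma signed_minkowski f g (t : R) (r := (1 - lam)^-1) :
  0 <= t <= 1 ->
  (forall x, 0 <= f x) -> (forall x, 0 <= g x) ->
  integrableR nu (fun x => f x `^ r) -> integrableR nu (fun x => g x `^ r) ->
  integrableR nu (fun x => (t * f x + (1 - t) * g x) `^ r) ->
  0 < \int[nu]_x (f x `^ r) -> 0 < \int[nu]_x (g x `^ r) ->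
  lam^-1 * (\int[nu]_x ((t * f x + (1 - t) * g x) `^ r)) `^ (1 - lam) <=
  lam^-1 * (t * (\int[nu]_x (f x `^ r)) `^ (1 - lam) +
            (1 - t) * (\int[nu]_x (g x `^ r)) `^ (1 - lam)).
Proof.
move=> t01 f0 g0 fi gi hi If Ig.
have qn0 : 1 - lam != 0 by rewrite subr_eq0 gt_eqF.
exact: (signed_minkowski_aux t01 f0 g0 fi gi hi (powR_gt0 (1 - lam) If)
  (powR_gt0 (1 - lam) Ig) (powRK qn0 (ltW If)) (powRK qn0 (ltW Ig))).
Qed.

End Minkowski.

(** * First-order expansions along the simplex *)

Section SimplexDifferential.
Context {R : realType} {d : nat}.
Implicit Types (u v eta : 'rV[R]_d.+1) (f L : 'rV[R]_d.+1 -> R).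

(** Names the differential of [simplex_differentiable] and leaves its linearity aside, so that
    explicit formulas can be handled first. *)
Definition simplex_diff f u L : Prop :=
  forall e : R, 0 < e -> \forall v \near (0 : 'rV[R]_d.+1),
    tangent v -> `|f (u + v) - f u - L v| <= e * `|v|.

Lemma norm_coord_le v i : `|v 0 i| <= `|v|.
Proof.
rewrite [leRHS]/Num.norm /= mx_normrE.
by apply/bigmax_geP; right => /=; exists (0, i).
Qed.

Lemma open_simplexW eta : open_simplex eta -> closed_simplex eta.
Proof. by case=> eta0 eta1; split=> // i; exact: ltW. Qed.

Lemma tangentB eta eta' : closed_simplex eta -> closed_simplex eta' ->
  tangent (eta - eta').
Proof.
move=> [_ s1] [_ s2]; rewrite /tangent /=.
under eq_bigr do rewrite !mxE.
by rewrite big_split /= sumrN s1 s2 subrr.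
Qed.

Lemma tangentZ h v : tangent v -> tangent (h *: v).
Proof.
rewrite /tangent /= => v0; under eq_bigr do rewrite mxE.
by rewrite -mulr_sumr v0 mulr0.
Qed.

(** The finitely many coordinates of [u] are positive, so a small [v] keeps them nonnegative;
    tangency preserves their sum. *)
Lemma near_closed_simplex u : open_simplex u ->
  \forall v \near (0 : 'rV[R]_d.+1), tangent v -> closed_simplex (u + v).
Proof.
move=> [u0 u1].
have uv i : \forall v \near (0 : 'rV[R]_d.+1), `|v| <= u 0 i.
  exact: (@nbhs0_le _ 'rV[R]_d.+1 _ (u0 i)).
have uv' : \forall v \near (0 : 'rV[R]_d.+1), forall i, `|v| <= u 0 i.
  exact: (@filter_forall _ _ (fun i v => `|v| <= u 0 i)
    (nbhs (0 : 'rV[R]_d.+1)) _ uv).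
apply: (filterS _ uv') => v vu; rewrite /tangent /= => tv; split.
  move=> i; rewrite mxE -lerBlDr sub0r.
  rewrite (le_trans _ (vu i))// (le_trans _ (norm_coord_le v i))//.
  by rewrite -normrN ler_norm.
by under eq_bigr do rewrite mxE; rewrite big_split /= u1 tv addr0.
Qed.

(** Small tangent steps from an interior point stay in the closed simplex, so agreement there is
    enough. The closed form of the entropy is established only there. *)
Lemma simplex_diff_ext f g u L : open_simplex u ->
  (forall eta, closed_simplex eta -> f eta = g eta) ->
  simplex_diff f u L -> simplex_diff g u L.
Proof.
move=> uo fg df e e0.
apply: (filterS2 _ _ (df e e0) (near_closed_simplex uo)) => v fv cv tv.
by rewrite -!fg; [exact: fv|exact: open_simplexW|exact: cv].
Qed.

(** The steps [h *: v] stay tangent, and the error bound divided by [|h|] is the convergence of the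
    difference quotient. *)
Lemma simplex_diff_derive f u L v : (forall h, L (h *: v) = h * L v) ->
  tangent v -> simplex_diff f u L -> 'D_v f u = L v.
Proof.
move=> LZ tv df; apply/cvg_lim => //.
apply/cvgrPdist_le => e e0.
(* The added 1 allows for [v = 0]. *)
have v1 : 0 < `|v| + 1 by rewrite ltr_wpDl.
have e1 : 0 < e / (`|v| + 1) by rewrite divr_gt0.
have [D /= D0 HD] := (@nbhs_ballP _ _ _ _).1 (df _ e1).
have DV : 0 < D / (`|v| + 1) by rewrite divr_gt0.
near=> h.
have hn0 : h != 0 by near: h; exact: nbhs_dnbhs_neq.
have hD : `|h| < D / (`|v| + 1) by near: h; exact: dnbhs0_lt.
have hvD : ball (0 : 'rV[R]_d.+1) D (h *: v).
  rewrite -ball_normE /= sub0r normrN normrZ.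
  apply: (le_lt_trans (y := `|h| * (`|v| + 1))).
    by rewrite ler_wpM2l// lerDl.
  by rewrite -ltr_pdivlMr.
have := HD _ hvD (tangentZ h tv); rewrite LZ normrZ [u + _]addrC => H.
have -> : L v - h^-1 *: ((f \o shift u) (h *: v) - f u) =
    - (h^-1 * (f (h *: v + u) - f u - h * L v)).
  rewrite /= -[h^-1 *: _]/(h^-1 * _); by field.
rewrite normrN normrM normfV ler_pdivrMl ?normr_gt0// (le_trans H)//.
rewrite mulrCA ler_wpM2l// mulrAC ler_pdivrMr//.
by rewrite ler_pM2l// lerDl.
Unshelve. all: by end_near. Qed.

Lemma derive_expansion (g : R -> R) (y g' : R) : is_derive y 1 g g' ->
  forall e : R, 0 < e -> exists2 D : R, 0 < D &
    forall h, `|h| < D -> `|g (y + h) - g y - g' * h| <= e * `|h|.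
Proof.
move=> [dg g'E] e e0.
have : h^-1 *: ((g \o shift y) (h *: 1) - g y) @[h --> (0 : R)^'] --> g'.
  by rewrite -g'E; exact: dg.
move=> /cvgrPdist_le /(_ e e0).
rewrite near_withinE => /nbhs_ballP[D /= D0 HD]; exists D => // h hD.
have [->|hn0] := eqVneq h 0.
  by rewrite addr0 subrr mulr0 subrr normr0 mulr0.
have := HD h; rewrite /ball /= sub0r normrN => /(_ hD hn0) H.
have -> : g (y + h) - g y - g' * h =
    - h * (g' - h^-1 *: ((g \o shift y) (h *: 1) - g y)).
  rewrite /= -[h^-1 *: _]/(h^-1 * _) -[h *: 1]/(h * 1) mulr1 [h + y]addrC.
  by field.
by rewrite normrM normrN mulrC ler_wpM2r.
Qed.

(** Chain rule. The error is that of [g] at the increment [h] of [f], plus [g'] times that of [f];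
    each gets half of [e]. The bound on [L] and the expansion of [f] with error 1 give
    [|h| <= (C + 1) * |v|]. *)
Lemma simplex_diff_comp (g : R -> R) (g' C : R) f u L : 0 < C ->
  is_derive (f u) 1 g g' -> (forall v, `|L v| <= C * `|v|) ->
  simplex_diff f u L -> simplex_diff (g \o f) u (fun v => g' * L v).
Proof.
move=> C0 dg LC df e e0.
have C1 : 0 < C + 1 by rewrite addr_gt0.
(* The added 1 keeps [e2] meaningful when [g'] is zero. *)
have g1 : 0 < `|g'| + 1 by rewrite ltr_wpDl.
have e1 : 0 < e / 2 / (C + 1) by rewrite !divr_gt0.
have e2 : 0 < e / 2 / (`|g'| + 1) by rewrite !divr_gt0.
have [D D0 HD] := derive_expansion dg e1.
have DC : 0 < D / (C + 1) by rewrite divr_gt0.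
apply: (filterS3 _ _ (df _ e2) (df 1 ltr01)
  (@nbhs0_lt _ 'rV[R]_d.+1 _ DC)) => v H2 H1 vD tv.
set h := f (u + v) - f u.
have hC : `|h| <= (C + 1) * `|v|.
  rewrite -[h](subrK (L v)) (le_trans (ler_normD _ _))//.
  by rewrite addrC mulrDl lerD// H1.
have hD : `|h| < D.
  by rewrite (le_lt_trans hC)// mulrC -ltr_pdivlMr.
have := HD h hD; rewrite {1}/h [X in g X]addrC subrK => Hg.
have -> : (g \o f) (u + v) - (g \o f) u - g' * L v =
    (g (f (u + v)) - g (f u) - g' * h) + g' * (h - L v) by rewrite /=; ring.
rewrite (le_trans (ler_normD _ _))// [e]splitr mulrDl lerD//.
  rewrite (le_trans Hg)//.
  by rewrite (le_trans (ler_wpM2l (ltW e1) hC))// mulrA divfK ?gt_eqF.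
rewrite normrM (le_trans (ler_wpM2l (normr_ge0 _) (H2 tv)))//.
rewrite mulrA ler_wpM2r//.
rewrite mulrC -[leRHS]mulr1 -!mulrA ler_pM2l ?ler_pM2l ?invr_gt0//.
by rewrite ler_pdivrMl// mulr1 lerDl.
Qed.

Lemma simplex_diff_differentiable f u L : (forall v w, L (v + w) = L v + L w) ->
  (forall k v, L (k *: v) = k * L v) ->
  simplex_diff f u L -> simplex_differentiable f u.
Proof.
move=> LD LZ df.
have L_linear : linear L by move=> k v w; rewrite LD LZ.
pose linL := GRing.isLinear.Build R 'rV[R]_d.+1 R _ L L_linear.
by exists (HB.pack L linL : {linear 'rV[R]_d.+1 -> R}).
Qed.

End SimplexDifferential.

(** * Linear combinations of nonnegative functions and the differential of the integral of their
    powers *)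

Definition lincomb {T : Type} {R : realType} {d : nat} (s : 'I_d.+1 -> T -> R)
    (eta : 'rV[R]_d.+1) (x : T) : R :=
  \sum_i eta 0 i * s i x.

(** A convenient constant above every [1 / u_i], which makes each [s i] at most [inv_sum u] times
    the combination at [u]. *)
Definition inv_sum {R : realType} {d : nat} (u : 'rV[R]_d.+1) : R :=
  \sum_i (u 0 i)^-1.

Section LinearCombination.
Context {dT : measure_display} {T : measurableType dT} {R : realType} {d : nat}.
Variables (nu : {measure set T -> \bar R}) (s : 'I_d.+1 -> T -> R) (r : R).
Hypotheses (s_ge0 : forall i x, 0 <= s i x) (r_gt0 : 0 < r).
Hypothesis s_integrable : forall i, integrableR nu (s i).
Implicit Types (u v eta : 'rV[R]_d.+1) (x : T).

Local Notation S := (lincomb s).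

Lemma lincomb_ge0 eta x : closed_simplex eta -> 0 <= S eta x.
Proof. by move=> [eta0 _]; apply: sumr_ge0 => i _; rewrite mulr_ge0. Qed.

Lemma lincombD u v x : S (u + v) x = S u x + S v x.
Proof.
by rewrite /lincomb -big_split; apply: eq_bigr => i _; rewrite mxE mulrDl.
Qed.

Lemma lincombZ k v x : S (k *: v) x = k * S v x.
Proof. by rewrite /lincomb mulr_sumr; apply: eq_bigr => i _; rewrite mxE mulrA. Qed.

Lemma integrableR_lincomb eta : integrableR nu (S eta).
Proof.
rewrite /lincomb; elim: (index_enum _) => [|i l IH].
  by under eq_fun do rewrite big_nil; exact: integrable0.
under eq_fun do rewrite big_cons.
by apply: integrableRD => //; exact: integrableRZl.
Qed.

Lemma Rintegral_lincomb eta :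
  \int[nu]_x S eta x = \sum_i eta 0 i * \int[nu]_x s i x.
Proof.
(* Integrability is carried along in the induction because additivity of the integral requires it
   for the tail. *)
have : integrableR nu (S eta) /\
    \int[nu]_x S eta x = \sum_i eta 0 i * \int[nu]_x s i x; last by case.
rewrite /lincomb; elim: (index_enum _) => [|i l [li IH]].
  under eq_fun do rewrite big_nil; rewrite big_nil; split.
    exact: integrable0.
  by rewrite /Rintegral integral0.
under eq_fun do rewrite big_cons.
have si := integrableRZl (eta 0 i) (s_integrable i).
split; first exact: integrableRD.
by rewrite RintegralD// IH big_cons RintegralZl//; exact: s_integrable.
Qed.

Lemma measurable_lincomb eta : measurable_fun setT (S eta).
Proof. exact: integrableR_measurable (integrableR_lincomb eta). Qed.

(* Every [s i] is at most a multiple of [S u]: this dominates the difference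
   quotients under the integral, uniformly in the direction. *)
Lemma lincomb_le u v x : open_simplex u -> `|S v x| <= inv_sum u * `|v| * S u x.
Proof.
move=> [u0 _]; rewrite (le_trans (ler_norm_sum _ _ _))// mulr_sumr.
apply: ler_sum => i _; rewrite normrM (ger0_norm (s_ge0 i x)) mulrA.
apply: ler_wpM2r => //; rewrite mulrAC.
(* It remains that [1 <= inv_sum u * u_i], true since [1 / u_i] is one of the nonnegative terms of
   [inv_sum u]. *)
apply: (le_trans (norm_coord_le v i)); rewrite ler_peMl//.
rewrite -ler_pdivrMr// mul1r /inv_sum (bigD1 i)//= lerDl.
by apply: sumr_ge0 => j _; rewrite invr_ge0 ltW.
Qed.

Lemma lincomb_eq0 u v x : open_simplex u -> S u x = 0 -> S v x = 0.
Proof.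
move=> uo Su0; have := lincomb_le v x uo.
by rewrite Su0 mulr0 normr_le0 => /eqP.
Qed.

Lemma inv_sum_gt0 u : open_simplex u -> 0 < inv_sum u.
Proof.
move=> [u0 _]; rewrite /inv_sum big_ord_recl /= ltr_pwDl ?invr_gt0//.
by apply: sumr_ge0 => i _; rewrite invr_ge0 ltW.
Qed.

Hypothesis pow_integrable : forall eta, closed_simplex eta ->
  integrableR nu (fun x => S eta x `^ r).

Let W eta := \int[nu]_x (S eta x `^ r).

(** From [lincomb_le] and [y * y ^ (r - 1) = y ^ r], which holds at [y = 0] too since [0 < r],
    although [r - 1] may be negative. *)
Lemma powR_lincomb_mul u v x : open_simplex u ->
  `|S u x `^ (r - 1) * S v x| <= inv_sum u * `|v| * S u x `^ r.
Proof.
move=> uo; have Su0 := lincomb_ge0 x (open_simplexW uo).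
rewrite normrM ger0_norm ?powR_ge0// -(mulr_powRB1 Su0 r_gt0).
by rewrite [leLHS]mulrC [leRHS]mulrA ler_wpM2r ?powR_ge0 ?lincomb_le.
Qed.

Lemma integrable_powR_lincomb_mul u v : open_simplex u ->
  integrableR nu (fun x => S u x `^ (r - 1) * S v x).
Proof.
move=> uo; apply: (@integrableR_le _ _ _ _ _
  (fun x => inv_sum u * `|v| * S u x `^ r)).
- apply: measurable_funM; last exact: measurable_lincomb.
  exact: (measurableT_comp (measurable_powR _) (measurable_lincomb _)).
- by apply: integrableRZl; apply: pow_integrable; exact: open_simplexW.
- by move=> x; exact: powR_lincomb_mul.
Qed.

(** The formal derivative under the integral of [W] at [u] along [v]; [simplex_diff_pow] shows that
    it is the differential. *)
Definition dpow u v : R := r * \int[nu]_x (S u x `^ (r - 1) * S v x).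

Lemma dpowZ u k v : open_simplex u -> dpow u (k *: v) = k * dpow u v.
Proof.
move=> uo; rewrite /dpow mulrCA; congr (_ * _).
rewrite -RintegralZl//; last exact: integrable_powR_lincomb_mul.
by apply: eq_Rintegral => x _; rewrite lincombZ mulrCA.
Qed.

Lemma dpowD u v w : open_simplex u -> dpow u (v + w) = dpow u v + dpow u w.
Proof.
move=> uo; rewrite /dpow -mulrDr; congr (_ * _).
rewrite -RintegralD//; [|exact: integrable_powR_lincomb_mul..].
by apply: eq_Rintegral => x _; rewrite lincombD mulrDr.
Qed.

(** Euler's identity: [W] is homogeneous of degree [r]. *)
Lemma dpow_self u : open_simplex u -> dpow u u = r * W u.
Proof.
move=> uo; congr (_ * _); apply: eq_Rintegral => x _.
by rewrite mulrC mulr_powRB1// lincomb_ge0//; exact: open_simplexW.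
Qed.

(** Supplies the bound on the inner differential that [simplex_diff_comp] asks for. *)
Lemma dpow_le u v : open_simplex u -> `|dpow u v| <= r * (inv_sum u * W u) * `|v|.
Proof.
move=> uo; have fi := integrable_powR_lincomb_mul v uo.
have Wi := pow_integrable (open_simplexW uo).
rewrite normrM gtr0_norm// -mulrA ler_pM2l//.
rewrite (le_trans (le_normr_Rintegral measurableT fi))// mulrAC.
rewrite -RintegralZl//; apply: le_Rintegral => //.
- exact: integrable_norm.
- exact: integrableRZl.
- by move=> x _; exact: powR_lincomb_mul.
Qed.

(** The ratio [h] of [S v] to [S u] is at most [inv_sum u * |v|] at every point, so a single
    expansion of [(1 + h) ^ r] serves all [x]. Its error, scaled by [S u ^ r], is then
    integrated. *)
Lemma simplex_diff_pow u : open_simplex u -> simplex_diff W u (dpow u).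
Proof.
move=> uo e e0; have uc := open_simplexW uo.
have C0 := inv_sum_gt0 uo.
have W0 : 0 <= W u by apply: Rintegral_ge0 => x _; exact: powR_ge0.
(* The integrated error is [e1 * inv_sum u * W u * |v|], so this denominator brings it below
   [e * |v|]; the 1 keeps it positive. *)
have CW1 : 0 < inv_sum u * W u + 1 by rewrite ltr_wpDl// mulr_ge0// ltW.
have e1 : 0 < e / (inv_sum u * W u + 1) by rewrite divr_gt0.
have [D D0 HD] := derive_expansion (is_derive1_powR r ltr01) e1.
have DC : 0 < D / inv_sum u by rewrite divr_gt0.
apply: (filterS2 _ _ (near_closed_simplex uo) (@nbhs0_lt _ 'rV[R]_d.+1 _ DC)).
move=> v uvc vD tv; have {}uvc := uvc tv.
have pw x : `|S (u + v) x `^ r - S u x `^ r - r * (S u x `^ (r - 1) * S v x)|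
    <= e / (inv_sum u * W u + 1) * inv_sum u * `|v| * S u x `^ r.
  have Su0 := lincomb_ge0 x uc; have Suv0 := lincomb_ge0 x uvc.
  (* Where [S u] vanishes no ratio can be formed, but there [S v] vanishes as well and the left side
     is 0. *)
  have [Sx0|Sxn0] := eqVneq (S u x) 0.
    rewrite lincombD (lincomb_eq0 v uo Sx0) addr0 subrr mulr0 mulr0 subrr normr0.
    by rewrite mulr_ge0 ?powR_ge0// mulr_ge0// mulr_ge0 ?(ltW e1) ?(ltW C0).
  have Sx_gt0 : 0 < S u x by rewrite lt_neqAle eq_sym Sxn0.
  pose h := S v x / S u x.
  have hC : `|h| <= inv_sum u * `|v|.
    by rewrite normrM normfV (gtr0_norm Sx_gt0) ler_pdivrMr// lincomb_le.
  have hD : `|h| < D.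
    by rewrite (le_lt_trans hC)// mulrC -ltr_pdivlMr.
  have SE : S (u + v) x = S u x * (1 + h).
    by rewrite lincombD mulrDr mulr1 /h mulrCA mulfV// mulr1.
  (* Nonnegativity of [S (u + v)] gives this; the product rule for powers needs it. *)
  have h1 : 0 <= 1 + h by rewrite -(pmulr_rge0 _ Sx_gt0) -SE.
  have -> : S (u + v) x `^ r - S u x `^ r - r * (S u x `^ (r - 1) * S v x) =
      S u x `^ r * ((1 + h) `^ r - 1 `^ r - r * 1 `^ (r - 1) * h).
    rewrite SE powRM// -(mulr_powRB1 Su0 r_gt0) !powR1.
    by rewrite /h; field.
  rewrite normrM ger0_norm ?powR_ge0// mulrC ler_wpM2r ?powR_ge0//.
  by rewrite (le_trans (HD _ hD))// -[leRHS]mulrA ler_wpM2l// ltW.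
have Wi := pow_integrable uc; have Wvi := pow_integrable uvc.
have di := integrableRZl r (integrable_powR_lincomb_mul v uo).
have bi := integrableRB Wvi Wi.
have -> : W (u + v) - W u - dpow u v =
    \int[nu]_x (S (u + v) x `^ r - S u x `^ r - r * (S u x `^ (r - 1) * S v x)).
  rewrite RintegralB// RintegralB// RintegralZl//.
  exact: integrable_powR_lincomb_mul.
rewrite (le_trans (le_normr_Rintegral measurableT (integrableRB bi di)))//.
apply: (le_trans (y := e / (inv_sum u * W u + 1) * inv_sum u * `|v| * W u)).
  rewrite -RintegralZl//; apply: le_Rintegral => //.
  - exact: integrable_norm (integrableRB bi di).
  - exact: integrableRZl.
rewrite mulrAC ler_wpM2r// -!mulrA ler_piMr//; first exact: ltW.
by rewrite ler_pdivrMl// mulr1 lerDl.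
Qed.

End LinearCombination.

(** * Scalar computations for convexity and for the divergence *)

(** The weights [t] and [1 - t] add up to 1, so the shift by -1 cancels. *)
Lemma ler_conv_shift {R : realType} (l t e e1 e2 w w1 w2 : R) :
  e = w -> e1 = w1 -> e2 = w2 ->
  l * w <= l * (t * w1 + (1 - t) * w2) ->
  l * (e - 1) <= t * (l * (e1 - 1)) + (1 - t) * (l * (e2 - 1)).
Proof.
move=> -> -> ->; rewrite -subr_ge0 => w_le; rewrite -subr_ge0.
suff <- : l * (t * w1 + (1 - t) * w2) - l * w =
  t * (l * (w1 - 1)) + (1 - t) * (l * (w2 - 1)) - l * (w - 1) by [].
by ring.
Qed.

Lemma lne_powR {R : realType} (q t w w' a : R) : 0 < w -> 0 < w' -> 0 < a ->
  lne ((w `^ q * w' `^ t)^-1 * a)%:E = (ln a - q * ln w - t * ln w')%:E.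
Proof.
move=> w0 w'0 a0; have wq : 0 < w `^ q by exact: powR_gt0.
have w't : 0 < w' `^ t by exact: powR_gt0.
have k0 : 0 < w `^ q * w' `^ t by exact: mulr_gt0.
have k'0 : 0 < (w `^ q * w' `^ t)^-1 by rewrite invr_gt0.
rewrite lne_EFin ?mulr_gt0//; congr (_%:E).
by rewrite lnM ?posrE// lnV ?posrE// lnM ?posrE// !ln_powR; ring.
Qed.

(** The powers [q] and [1 - q] of the quotients give [a / w ^ q] and [b ^ (1/q - 1) / w' ^ (1 - q)].
    The implication from [b = 0] to [a = 0] rules out the infinite branch; for [a = 0] both sides
    are 0. *)
Lemma renyi_integrand_powR {R : realType} (q a b w w' : R) :
  0 < q -> 0 <= a -> 0 <= b -> 0 < w -> 0 < w' -> (b = 0 -> a = 0) ->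
  renyi_integrand q (a `^ q^-1 / w) (b `^ q^-1 / w') =
  ((w `^ q * w' `^ (1 - q))^-1 * (b `^ (q^-1 - 1) * a))%:E.
Proof.
move=> q0 a0 b0 w0 w'0 ba.
have eq0 (c v : R) : 0 < v -> (c `^ q^-1 / v == 0) = (c == 0).
  move=> v0; rewrite mulf_eq0 invr_eq0 (gt_eqF v0) orbF powR_eq0.
  by rewrite invr_eq0 (gt_eqF q0) andbT.
rewrite /renyi_integrand !eq0//.
have [->|an0] := eqVneq a 0; first by rewrite !mulr0.
have bn0 : b != 0 by apply: contra_neq an0.
rewrite (negbTE bn0) /=; congr (_%:E).
rewrite !powR_div ?powR_ge0 ?(ltW w0) ?(ltW w'0)// powRVK ?gt_eqF//.
rewrite -powRrM mulrBr mulr1 mulVf ?gt_eqF// invfM; ring.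
Qed.

Lemma closed_simplex_conv {R : realType} {d : nat} (t : R)
    (eta eta' : 'rV[R]_d.+1) : 0 <= t <= 1 ->
  closed_simplex eta -> closed_simplex eta' ->
  closed_simplex (t *: eta + (1 - t) *: eta').
Proof.
move=> /andP[t0 t1] [e0 e1] [e'0 e'1]; split.
  by move=> i; rewrite !mxE addr_ge0// mulr_ge0// subr_ge0.
under eq_bigr do rewrite !mxE.
by rewrite big_split /= -!mulr_sumr e1 e'1 !mulr1 addrC subrK.
Qed.

(** * The mixture family: normalization, entropy, divergences and convexity *)

Section LambdaMixture.
Context {dT : measure_display} {T : measurableType dT} {R : realType} {d : nat}.
Variables (nu : {measure set T -> \bar R}) (p : 'I_d.+1 -> T -> R) (lam : R).
Hypotheses (lam_lt1 : lam < 1) (lam_neq0 : lam != 0).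
Hypothesis p_density : forall i, density nu (p i).
Hypothesis escort_cvg :
  forall i, integrableR nu (fun x => p i x `^ (1 - lam)).
Hypothesis mixture_cvg : forall eta : 'rV[R]_d.+1, closed_simplex eta ->
  integrableR nu (escort_sum_pow nu lam p eta).
Implicit Types (eta : 'rV[R]_d.+1) (x : T).

Let q := 1 - lam.
Let r := q^-1.
Let s i := escort nu q (p i).
Let S := escort_sum nu lam p.
Let W eta := \int[nu]_x (S eta x `^ r).
Let mix := lambda_mixture nu lam p.
Let psi := neg_renyi_entropy nu lam p.

Let q_gt0 : 0 < q. Proof. by rewrite subr_gt0. Qed.
Let q_neq0 : q != 0. Proof. by rewrite gt_eqF. Qed.
Let r_gt0 : 0 < r. Proof. by rewrite invr_gt0. Qed.
Let r_neq0 : r != 0. Proof. by rewrite gt_eqF. Qed.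
Let subrq : 1 - q = lam. Proof. by rewrite subKr. Qed.

(** The power [p_i ^ q] vanishes only where [p_i] does, and [p_i] has integral 1. *)
Lemma escort_norm_gt0 i : 0 < \int[nu]_x (p i x `^ q).
Proof.
have [mp p0 p1] := p_density i.
apply: (Rintegral_gt0 (escort_cvg i) mp) => //.
- by move=> x; exact: powR_ge0.
- by move=> x; exact: powR_eq0_eq0.
- by rewrite p1 lte01.
Qed.

Lemma escort_ge0 i x : 0 <= s i x.
Proof. by rewrite /s /escort divr_ge0 ?powR_ge0// ltW// escort_norm_gt0. Qed.

Lemma integrable_escort i : integrableR nu (s i).
Proof.
rewrite /s /escort; under eq_fun do rewrite mulrC.
by apply: integrableRZl; exact: escort_cvg.
Qed.

Lemma Rintegral_escort i : \int[nu]_x s i x = 1.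
Proof.
rewrite /s /escort (RintegralZr _ measurableT (escort_cvg i)).
by rewrite divff// gt_eqF// escort_norm_gt0.
Qed.

(** [escort_sum] is convertible to [lincomb] of the escort densities, so the results on [lincomb]
    apply directly. *)
Lemma escort_sum_ge0 eta x : closed_simplex eta -> 0 <= S eta x.
Proof. exact: (lincomb_ge0 escort_ge0). Qed.

Lemma integrable_escort_sum eta : integrableR nu (S eta).
Proof. exact: (integrableR_lincomb integrable_escort). Qed.

Lemma Rintegral_escort_sum eta : closed_simplex eta -> \int[nu]_x S eta x = 1.
Proof.
move=> [_ eta1]; rewrite [LHS](Rintegral_lincomb integrable_escort) -[RHS]eta1.
by apply: eq_bigr => i _; rewrite Rintegral_escort mulr1.
Qed.

Lemma integral_escort_sum eta : closed_simplex eta ->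
  (\int[nu]_x (S eta x)%:E = 1)%E.
Proof.
move=> eta_cl; rewrite (EFin_Rintegral (integrable_escort_sum eta)).
by rewrite Rintegral_escort_sum.
Qed.

Lemma mixture_norm_gt0 eta : closed_simplex eta -> 0 < W eta.
Proof.
move=> eta_cl.
apply: (Rintegral_gt0 (mixture_cvg eta_cl)
  (integrableR_measurable (integrable_escort_sum eta))).
- by move=> x; exact: powR_ge0.
- by move=> x; exact: escort_sum_ge0.
- by move=> x; exact: powR_eq0_eq0.
- by rewrite integral_escort_sum// lte01.
Qed.

Lemma lambda_mixtureE eta x : mix eta x = S eta x `^ r / W eta.
Proof. by []. Qed.

Lemma lambda_mixture_powR eta x : closed_simplex eta ->
  mix eta x `^ q = S eta x / W eta `^ q.
Proof.
move=> eta_cl; have W0 := ltW (mixture_norm_gt0 eta_cl).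
rewrite lambda_mixtureE (powR_div _ (powR_ge0 _ _) W0) (powRVK q_neq0)//.
exact: escort_sum_ge0.
Qed.

(** The value is a real number, so [fine] in [neg_renyi_entropy] loses nothing on the closed
    simplex. *)
Lemma renyi_entropyE eta : closed_simplex eta ->
  renyi_entropy nu q (mix eta) = (- (q / lam * ln (W eta)))%:E.
Proof.
move=> eta_cl; have W0 := mixture_norm_gt0 eta_cl.
have Wq0 : 0 < (W eta `^ q)^-1 by rewrite invr_gt0 powR_gt0.
rewrite /renyi_entropy subrq.
under eq_integral do rewrite (lambda_mixture_powR _ eta_cl) mulrC.
rewrite (EFin_Rintegral (integrableRZl _ (integrable_escort_sum eta))).
rewrite (RintegralZl _ measurableT (integrable_escort_sum eta)).
rewrite Rintegral_escort_sum// mulr1 lne_EFin//.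
rewrite lnV ?posrE ?powR_gt0// ln_powR -EFinM; congr (_%:E); ring.
Qed.

Lemma neg_renyi_entropyE eta : closed_simplex eta ->
  psi eta = q / lam * ln (W eta).
Proof.
by move=> eta_cl; rewrite /psi /neg_renyi_entropy renyi_entropyE//= opprK.
Qed.

Lemma expR_neg_renyi_entropy eta : closed_simplex eta ->
  expR (lam * psi eta) = W eta `^ q.
Proof.
move=> eta_cl; have W0 := mixture_norm_gt0 eta_cl.
by rewrite neg_renyi_entropyE// mulrA (mulrC lam) divfK// /powR gt_eqF.
Qed.

(** Chain rule for [q / lam * ln] after [W], the form that the entropy takes on the closed
    simplex. *)
Lemma simplex_diff_neg_renyi_entropy eta : open_simplex eta ->
  simplex_diff psi eta (fun v => q / lam * (W eta)^-1 * dpow nu s r eta v).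
Proof.
move=> eta_op; have eta_cl := open_simplexW eta_op.
have W0 := mixture_norm_gt0 eta_cl.
apply: (simplex_diff_ext eta_op (f := (fun y => q / lam * ln y) \o W)).
  by move=> eta' /neg_renyi_entropyE ->.
have dW := simplex_diff_pow escort_ge0 r_gt0 integrable_escort mixture_cvg eta_op.
have LC v := dpow_le escort_ge0 r_gt0 integrable_escort mixture_cvg v eta_op.
apply: (simplex_diff_comp _ _ LC dW).
  by rewrite !mulr_gt0// inv_sum_gt0.
exact: (is_deriveZ (q / lam) (is_derive1_ln W0)).
Qed.

(** Up to the factor [r], the differential of [W] at [eta'] applied to [eta]. Both divergences
    reduce to it. *)
Let A eta eta' := \int[nu]_x (S eta' x `^ (r - 1) * S eta x).

(** The integrand vanishes only where [S eta] does: a zero of [S eta'] is also one of [S eta], as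
    [eta'] is interior. *)
Lemma cross_integral_gt0 eta eta' : closed_simplex eta -> open_simplex eta' ->
  0 < A eta eta'.
Proof.
move=> eta_cl eta'_op.
apply: (Rintegral_gt0 (integrable_powR_lincomb_mul escort_ge0 r_gt0
    integrable_escort mixture_cvg eta eta'_op)
  (integrableR_measurable (integrable_escort_sum eta))).
- by move=> x; rewrite mulr_ge0 ?powR_ge0 ?escort_sum_ge0.
- by move=> x; exact: escort_sum_ge0.
- move=> x /eqP; rewrite mulf_eq0 => /orP[|/eqP//] /eqP /powR_eq0_eq0.
  exact: (lincomb_eq0 escort_ge0).
- by rewrite integral_escort_sum// lte01.
Qed.

(** By linearity and Euler's identity the differential of [W] at [eta'] along [eta - eta'] is
    [r * (A - W)]; as [q * r = 1], that of [psi] is [(A / W - 1) / lam]. *)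
Lemma log_div_arg_neg_renyi_entropy eta eta' :
  closed_simplex eta -> open_simplex eta' ->
  log_div_arg lam psi eta eta' = A eta eta' / W eta'.
Proof.
move=> eta_cl eta'_op; have eta'_cl := open_simplexW eta'_op.
have W0 := mixture_norm_gt0 eta'_cl.
have Z := dpowZ escort_ge0 r_gt0 integrable_escort mixture_cvg _ _ eta'_op.
rewrite /log_div_arg (simplex_diff_derive _ (tangentB eta_cl eta'_cl)
  (simplex_diff_neg_renyi_entropy eta'_op)); last first.
  by move=> h; rewrite Z mulrCA.
rewrite (dpowD escort_ge0 r_gt0 integrable_escort mixture_cvg _ _ eta'_op).
have Esd : dpow nu s r eta' eta' = r * W eta'.
  exact: (dpow_self nu escort_ge0 r_gt0 eta'_op).
have EA : dpow nu s r eta' eta = r * A eta eta' by [].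
rewrite -scaleN1r Z Esd EA.
move: (A eta eta') (W eta') W0 => a w w0.
by rewrite /r; field; rewrite q_neq0 lam_neq0 gt_eqF.
Qed.

Lemma renyi_integrandE eta eta' x : closed_simplex eta -> open_simplex eta' ->
  renyi_integrand q (mix eta x) (mix eta' x) =
  ((W eta `^ q * W eta' `^ lam)^-1 * (S eta' x `^ (r - 1) * S eta x))%:E.
Proof.
move=> eta_cl eta'_op; have eta'_cl := open_simplexW eta'_op.
rewrite -subrq; apply: (renyi_integrand_powR q_gt0 (escort_sum_ge0 x eta_cl)
  (escort_sum_ge0 x eta'_cl) (mixture_norm_gt0 eta_cl)
  (mixture_norm_gt0 eta'_cl)).
exact: (lincomb_eq0 escort_ge0).
Qed.

Lemma renyi_divE eta eta' : closed_simplex eta -> open_simplex eta' ->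
  renyi_div nu q (mix eta) (mix eta') =
  (lam^-1 * (q * ln (W eta) + lam * ln (W eta') - ln (A eta eta')))%:E.
Proof.
move=> eta_cl eta'_op; have eta'_cl := open_simplexW eta'_op.
have W0 := mixture_norm_gt0 eta_cl; have W'0 := mixture_norm_gt0 eta'_cl.
have A0 := cross_integral_gt0 eta_cl eta'_op.
have Ai := integrable_powR_lincomb_mul escort_ge0 r_gt0 integrable_escort
  mixture_cvg eta eta'_op.
rewrite /renyi_div.
under eq_integral do rewrite (renyi_integrandE _ eta_cl eta'_op).
rewrite (EFin_Rintegral (integrableRZl _ Ai)).
rewrite (RintegralZl _ measurableT Ai) -/(A eta eta').
rewrite (lne_powR q lam W0 W'0 A0) -opprB subrq invrN -EFinM.
move: (A eta eta') (W eta) (W eta') => a w w'.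
by congr (_%:E); ring.
Qed.

(** The term [psi eta'] and the denominator of the logarithm's argument give [ln (W eta')] the total
    coefficient [(1 - q) / lam = 1]. *)
Lemma log_divE eta eta' : closed_simplex eta -> open_simplex eta' ->
  log_div lam psi eta eta' =
  lam^-1 * (q * ln (W eta) + lam * ln (W eta') - ln (A eta eta')).
Proof.
move=> eta_cl eta'_op; have eta'_cl := open_simplexW eta'_op.
have W'0 := mixture_norm_gt0 eta'_cl.
rewrite /log_div log_div_arg_neg_renyi_entropy// !neg_renyi_entropyE//.
have := cross_integral_gt0 eta_cl eta'_op.
move: (A eta eta') (W eta) (W eta') W'0 => a w w' w'0 a0.
by rewrite ln_div ?posrE// /q; field.
Qed.

Lemma conv_neg_renyi_entropy (t : R) eta eta' : 0 <= t <= 1 ->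
  closed_simplex eta -> closed_simplex eta' ->
  lam^-1 * (expR (lam * psi (t *: eta + (1 - t) *: eta')) - 1) <=
  t * (lam^-1 * (expR (lam * psi eta) - 1)) +
  (1 - t) * (lam^-1 * (expR (lam * psi eta') - 1)).
Proof.
move=> t01 eta_cl eta'_cl.
have e_cl := closed_simplex_conv t01 eta_cl eta'_cl.
have SE x : S (t *: eta + (1 - t) *: eta') x =
    t * S eta x + (1 - t) * S eta' x.
  exact: (etrans (lincombD _ _ _ x)
    (congr2 +%R (lincombZ s _ _ x) (lincombZ s _ _ x))).
have ei : integrableR nu (fun x => (t * S eta x + (1 - t) * S eta' x) `^ r).
  by under eq_fun do rewrite -SE; exact: mixture_cvg e_cl.
have WE : W (t *: eta + (1 - t) *: eta') =
    \int[nu]_x ((t * S eta x + (1 - t) * S eta' x) `^ r).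
  by apply: eq_Rintegral => x _; rewrite SE.
apply: (ler_conv_shift (etrans (expR_neg_renyi_entropy e_cl)
    (congr1 (fun w => w `^ q) WE))
  (expR_neg_renyi_entropy eta_cl) (expR_neg_renyi_entropy eta'_cl)).
exact: (signed_minkowski lam_lt1 lam_neq0 t01
  (fun x => escort_sum_ge0 x eta_cl) (fun x => escort_sum_ge0 x eta'_cl)
  (mixture_cvg eta_cl) (mixture_cvg eta'_cl) ei
  (mixture_norm_gt0 eta_cl) (mixture_norm_gt0 eta'_cl)).
Qed.

Lemma convex_neg_renyi_entropy :
  convex_function closed_simplex
    (fun eta => lam^-1 * (expR (lam * psi eta) - 1)).
Proof.
move=> t eta eta' /set_mem eta_cl /set_mem eta'_cl.
(* The abstract convex combinations, of vectors and of reals, unfold to the explicit ones. *)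
apply: conv_neg_renyi_entropy => //.
by apply/andP; split.
Qed.

End LambdaMixture.

Theorem theorem4p8 (R : realType) (dT : measure_display)
  (T : measurableType dT) (nu : {measure set T -> \bar R})
  (d : nat) (p : 'I_d.+1 -> T -> R) (lam : R)
  (lam_lt1 : lam < 1) (lam_neq0 : lam != 0)
  (p_density : forall i, density nu (p i))
  (escort_cvg : forall i, integrableR nu (fun x => p i x `^ (1 - lam)))
  (mixture_cvg : forall eta : 'rV[R]_d.+1, closed_simplex eta ->
     integrableR nu (escort_sum_pow nu lam p eta))
  (mixture_derive : forall eta v : 'rV[R]_d.+1,
     open_simplex eta -> tangent v ->
     derive_under_integral nu (escort_sum_pow nu lam p) eta v) :
  let q := 1 - lam in
  let mix := lambda_mixture nu lam p in
  let psi := neg_renyi_entropy nu lam p in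
  [/\ forall eta, closed_simplex eta ->
        renyi_entropy nu q (mix eta) \is a fin_num,
      convex_function closed_simplex
        (fun eta => lam^-1 * (expR (lam * psi eta) - 1)),
      forall eta', open_simplex eta' -> simplex_differentiable psi eta' &
      forall eta eta', closed_simplex eta -> open_simplex eta' ->
        0 < log_div_arg lam psi eta eta' /\
        (log_div lam psi eta eta')%:E = renyi_div nu q (mix eta) (mix eta')].
Proof.
move=> q mix psi; split.
- by move=> eta eta_cl; rewrite /q /mix renyi_entropyE.
- exact: convex_neg_renyi_entropy.
- move=> eta' eta'_op.
  have q_gt0 : 0 < (1 - lam)^-1 by rewrite invr_gt0 subr_gt0.
  have s_ge0 := escort_ge0 p_density escort_cvg.
  have s_int := integrable_escort escort_cvg.
  have dpsi := simplex_diff_neg_renyi_entropy lam_lt1 p_density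
    escort_cvg mixture_cvg eta'_op.
  (* The differential is a constant multiple of [dpow], from which it inherits linearity. *)
  apply: (simplex_diff_differentiable _ _ dpsi) => [v w|k v].
    by rewrite (dpowD s_ge0 q_gt0 s_int mixture_cvg v w eta'_op) mulrDr.
  by rewrite (dpowZ s_ge0 q_gt0 s_int mixture_cvg k v eta'_op) mulrCA.
- move=> eta eta' eta_cl eta'_op; split.
    rewrite log_div_arg_neg_renyi_entropy// divr_gt0//.
      exact: cross_integral_gt0.
    exact: (mixture_norm_gt0 p_density escort_cvg mixture_cvg
      (open_simplexW eta'_op)).
  by rewrite renyi_divE// log_divE.
Qed.
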